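(* Let the integers $s(n)$ and $b(n)$ ($n \geq 1$) be defined by the $q$-expansions $$\psi(z) = \frac{\Delta(z)}{\Delta(2z)} = q^{-1} - 24 + \sum_{n=1}^\infty s(n) q^n, \qquad \phi(z) = \frac{1}{\psi(z)} = \sum_{n=1}^\infty b(n) q^n .$$ Then for all integers $n \geq 1$, $$|s(n)| < 0.9 \cdot n^{11} \cdot e^{2\pi \sqrt{2n}}, \qquad b(n) < 0.08 \cdot n^{11} \cdot e^{2\pi \sqrt{2n}}.$$
   Context: Here $q = e^{2\pi i z}$ with $z$ in the complex upper half-plane, and $\Delta(z) = q \prod_{n=1}^\infty (1-q^n)^{24}$. *)

(* Defs.v *)
From Stdlib Require Import Reals ZArith.
From Coquelicot Require Import Coquelicot.

Open Scope R_scope.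

(* exp (x + i y) = e^x (cos y + i sin y) *)
Definition Cexp (w : C) : C :=
  (exp (Re w) * (cos (Im w), sin (Im w)))%C.

Definition nome (z : C) : C := Cexp (2 * PI * Ci * z)%C.

(* f 1 * f 2 * ... * f N *)
Fixpoint Cprod1 (f : nat -> C) (N : nat) : C :=
  match N with
  | O => 1%C
  | S k => (Cprod1 f k * f (S k))%C
  end.

(* Limit of the partial products.  [lim] is total; its value is meaningful
   when they converge, in particular for the product in [Delta] when
   0 < Im z. *)
Definition Cprod1_inf (f : nat -> C) : C :=
  lim (T := C_R_CompleteNormedModule) (filtermap (Cprod1 f) eventually).

Definition Delta (z : C) : C :=
  (nome z * Cprod1_inf (fun n => (1 - nome z ^ n) ^ 24))%C.

Definition psi (z : C) : C := (Delta z / Delta (2 * z))%C.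

Definition phi (z : C) : C := (1 / psi z)%C.

(* The sum of a(n) q^n over n >= 1 converges to l, where q = nome z;
   a(0) is not used. *)
Definition is_qseries (a : nat -> Z) (z l : C) : Prop :=
  is_series (K := C_AbsRing) (V := C_NormedModule)
    (fun k : nat => (IZR (a (S k)) * nome z ^ (S k))%C) l.

(* Main.v *)
(* Both bounds are Cauchy estimates on circles |q| = e^-u. From
   psi = q^-1 prod (1 - q^(2m-1))^24 one gets, with x = |q| = e^-u,
     |q psi| <= exp (24 x / (1 - x^2)) <= exp (12 / u),
     |phi| <= x prod (1 - x^(2m-1))^-24 <= x exp (2 pi^2 / u);
   the last inequality follows by expanding -log (1 - y), summing the geometric
   series to 1 / (2 sinh (k u)) <= 1 / (2 k u), and using sum 1/k^2 <= pi^2/6.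
   For b(n) the radius u = 2 pi / sqrt (2n) gives exactly the exponent
   2 pi sqrt (2n); for s(n) the exponent has room to spare as soon as n >= 2. *)
Require Import Defs.
From Stdlib Require Import Reals ZArith.
From Coquelicot Require Import Coquelicot.
From Stdlib Require Import Lra Lia.

(** Interchanges of limits are avoided throughout. The logarithm series, the double sum behind the
    bound for [phi] and the power series under the integral are truncated with an explicit error,
    and only inequalities between real sequences pass to the limit. The infinite product over odd
    exponents is never formed either: finite products at [q] and [q * q] are compared in modulus,
    and that comparison survives in the limit. Two facts have to be secured for this: the product in
    [Delta] converges, since [lim] is total, and its limit is nonzero, since [psi] and [phi] are
    quotients. The exact Basel constant matters: 24 * pi^2 / 12 = 2 pi^2 is what produces the
    exponent 2 pi sqrt (2n), and a weaker bound on sum 1/k^2 would enlarge the exponent beyond what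
    n^11 absorbs for large n. By contrast 0.9 and 0.08 are at stake only for n = 1, because n^11 >=
    2048 afterwards. *)

Lemma exp_monotone (x y : R) : x <= y -> exp x <= exp y.
Proof.
  intros [H| ->]; [left; apply exp_increasing, H | right; reflexivity].
Qed.

Lemma exp_pow (y : R) (n : nat) : exp y ^ n = exp (INR n * y).
Proof.
  rewrite <- Rpower_pow by apply exp_pos. unfold Rpower. rewrite ln_exp. reflexivity.
Qed.

Lemma exp_neg_lt_1 (v : R) : 0 < v -> 0 < exp (- v) < 1.
Proof.
  intros Hv. split; [apply exp_pos|]. rewrite <- exp_0. apply exp_increasing; lra.
Qed.

Lemma pow_S_bounds (x : R) (n : nat) : 0 <= x < 1 -> 0 <= x ^ S n <= x.
Proof.
  intros Hx. split; [apply pow_le; lra|].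
  assert (0 <= x ^ n <= 1); [|simpl; nra].
  split; [apply pow_le; lra|]. rewrite <- (pow1 n). apply pow_incr; lra.
Qed.

(** * The partial sums of the Basel series *)

(** Wallis integrals; [Jcos] is their companion with weight x^2. Two recurrences between them make
    1/m^2 telescope. *)
Definition Icos (n : nat) : R := RInt (fun x => cos x ^ (2 * n)) 0 (PI / 2).
Definition Jcos (n : nat) : R := RInt (fun x => x ^ 2 * cos x ^ (2 * n)) 0 (PI / 2).

Lemma Icos_is_RInt (n : nat) :
  is_RInt (fun x => cos x ^ (2 * n)) 0 (PI / 2) (Icos n).
Proof.
  apply (RInt_correct (V := R_CompleteNormedModule)),
    (ex_RInt_continuous (V := R_CompleteNormedModule)).
  intros x _. apply (ex_derive_continuous (V := R_NormedModule)). auto_derive. exact I.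
Qed.

Lemma Jcos_is_RInt (n : nat) :
  is_RInt (fun x => x ^ 2 * cos x ^ (2 * n)) 0 (PI / 2) (Jcos n).
Proof.
  apply (RInt_correct (V := R_CompleteNormedModule)),
    (ex_RInt_continuous (V := R_CompleteNormedModule)).
  intros x _. apply (ex_derive_continuous (V := R_NormedModule)). auto_derive. exact I.
Qed.

(** Integration by parts is packaged this way: the boundary terms are collected in [F], which takes
    equal values at the two ends, so the identity between integrals reduces to differentiating
    [F]. *)
Lemma is_RInt_vanishing_primitive (F f : R -> R) (a b v : R) :
  (forall x, is_derive F x (f x)) -> (forall x, ex_derive f x) ->
  F a = F b -> is_RInt f a b v -> v = 0.
Proof.
  intros HF Hf Hab Hv.
  assert (H : is_RInt f a b (minus (F b) (F a))).
  { apply (is_RInt_derive (V := R_CompleteNormedModule)); intros x _; [apply HF|].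
    apply (ex_derive_continuous (V := R_NormedModule)), Hf. }
  rewrite <- (is_RInt_unique (V := R_CompleteNormedModule) _ _ _ _ Hv).
  rewrite (is_RInt_unique (V := R_CompleteNormedModule) _ _ _ _ H), Hab.
  unfold minus, plus, opp; simpl; ring.
Qed.

Lemma Icos_rec (n : nat) :
  (2 * INR n + 2) * Icos (S n) = (2 * INR n + 1) * Icos n.
Proof.
  apply Rminus_diag_uniq.
  apply (is_RInt_vanishing_primitive (fun x => sin x * cos x ^ (2 * n + 1))
    (fun x => (2 * INR n + 2) * cos x ^ (2 * S n) - (2 * INR n + 1) * cos x ^ (2 * n))
    0 (PI / 2)).
  - intros x. auto_derive; [exact I|].
    change (n + (n + 0))%nat with (2 * n)%nat.
    replace (Init.Nat.pred (2 * n + 1)) with (2 * n)%nat by lia.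
    replace (2 * S n)%nat with (2 * n + 2)%nat by lia.
    rewrite plus_INR, mult_INR, !pow_add. simpl INR.
    generalize (cos x ^ (2 * n)) (sin2_cos2 x). unfold Rsqr. intros y Hsc.
    apply Rminus_diag_uniq.
    transitivity ((2 * INR n + 1) * y * (1 - (sin x * sin x + cos x * cos x)));
      [simpl pow; ring | rewrite Hsc; ring]. 
  - intros x. auto_derive. exact I.
  - rewrite cos_PI2, sin_0, pow_i by lia. ring.
  - apply (is_RInt_minus (V := R_NormedModule));
      apply (is_RInt_scal (V := R_NormedModule)), Icos_is_RInt.
Qed.

Lemma Icos_Jcos (n : nat) :
  Icos (S n) = INR (S n) * ((2 * INR n + 1) * Jcos n - 2 * INR (S n) * Jcos (S n)).
Proof.
  apply Rminus_diag_uniq. rewrite S_INR.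
  replace (_ - _) with (Icos (S n) - ((INR n + 1) * (2 * INR n + 1) * Jcos n
    - 2 * (INR n + 1) ^ 2 * Jcos (S n))) by ring.
  (* The primitive gathers the boundary terms of two integrations by parts of cos^(2n+2),
     integrating first 1 and then x; both terms vanish at 0 and at pi/2. *)
  apply (is_RInt_vanishing_primitive
    (fun x => x * cos x ^ (2 * n + 2) + (INR n + 1) * x ^ 2 * sin x * cos x ^ (2 * n + 1))
    (fun x => cos x ^ (2 * S n) -
       ((INR n + 1) * (2 * INR n + 1) * (x ^ 2 * cos x ^ (2 * n))
        - 2 * (INR n + 1) ^ 2 * (x ^ 2 * cos x ^ (2 * S n))))
    0 (PI / 2)).
  - intros x. auto_derive; [exact I|].
    change (n + (n + 0))%nat with (2 * n)%nat.
    replace (Init.Nat.pred (2 * n + 1)) with (2 * n)%nat by lia.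
    replace (Init.Nat.pred (2 * n + 2)) with (2 * n + 1)%nat by lia.
    replace (2 * S n)%nat with (2 * n + 2)%nat by lia.
    rewrite !plus_INR, mult_INR, !pow_add. simpl INR.
    generalize (cos x ^ (2 * n)) (sin2_cos2 x). unfold Rsqr. intros y Hsc.
    apply Rminus_diag_uniq.
    transitivity ((INR n + 1) * x ^ 2 * (2 * INR n + 1) * y * (1 - (sin x * sin x + cos x * cos x)));
      [simpl pow; ring | rewrite Hsc; ring].
  - intros x. auto_derive. exact I.
  - rewrite cos_PI2, !pow_i by lia. ring.
  - apply (is_RInt_minus (V := R_NormedModule)); [apply Icos_is_RInt|].
    apply (is_RInt_minus (V := R_NormedModule));
      apply (is_RInt_scal (V := R_NormedModule)), Jcos_is_RInt.
Qed.

Lemma Icos_pos (n : nat) : 0 < Icos n.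
Proof.
  induction n as [|n IH].
  - unfold Icos. rewrite (RInt_ext _ (fun _ => 1)) by reflexivity.
    rewrite RInt_const. unfold scal; simpl; unfold mult; simpl.
    generalize PI_RGT_0; lra.
  - assert (Hn := pos_INR n).
    apply (Rmult_lt_reg_l (2 * INR n + 2)); [lra|].
    rewrite Icos_rec, Rmult_0_r. apply Rmult_lt_0_compat; lra.
Qed.

Lemma Jcos_ge0 (n : nat) : 0 <= Jcos n.
Proof.
  apply RInt_ge_0.
  - generalize PI_RGT_0; lra.
  - eexists; apply Jcos_is_RInt.
  - intros x _. rewrite pow_mult. apply Rmult_le_pos; [apply pow2_ge_0|].
    apply pow_le, pow2_ge_0.
Qed.

Lemma Jcos_0 : Jcos 0 = PI ^ 3 / 24.
Proof.
  apply is_RInt_unique.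
  replace (PI ^ 3 / 24) with (minus ((PI/2) ^ 3 / 3) (0 ^ 3 / 3))
    by (unfold minus, plus, opp; simpl; field).
  apply (is_RInt_derive (V := R_CompleteNormedModule) (fun x => x ^ 3 / 3)).
  - intros x _. auto_derive; [exact I|]. simpl. field.
  - intros x _. apply (ex_derive_continuous (V := R_NormedModule)). auto_derive. exact I.
Qed.

Lemma Icos_0 : Icos 0 = PI / 2.
Proof.
  unfold Icos. rewrite (RInt_ext _ (fun _ => 1)) by reflexivity.
  rewrite RInt_const. unfold scal; simpl; unfold mult; simpl. ring.
Qed.

(* Daners' proof of the Basel identity: 1/m^2 is a difference of successive
   values of 2 Jcos/Icos. *)
Lemma sum_inv_squares (n : nat) :
  sum_f_R0 (fun k => / INR (S k) ^ 2) n = PI ^ 2 / 6 - 2 * (Jcos (S n) / Icos (S n)).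
Proof.
  assert (Hstep : forall m, / INR (S m) ^ 2
            = 2 * (Jcos m / Icos m) - 2 * (Jcos (S m) / Icos (S m))).
  { intros m. assert (H0 := Icos_pos m). assert (H1 := Icos_pos (S m)).
    assert (Hr := Icos_rec m). assert (HJ := Icos_Jcos m).
    assert (Hm := pos_INR m). rewrite S_INR in *.
    assert (HI : Icos m = (2 * INR m + 2) * Icos (S m) / (2 * INR m + 1)).
    { rewrite Hr. field. lra. }
    rewrite HI.
    apply (Rmult_eq_reg_r (Icos (S m))); [|lra].
    rewrite HJ at 1. field. repeat split; lra. }
  induction n as [|n IH].
  - change (/ INR 1 ^ 2 = PI ^ 2 / 6 - 2 * (Jcos 1 / Icos 1)). rewrite (Hstep 0%nat), Jcos_0, Icos_0.
    assert (H1 := Icos_pos 1). field. generalize PI_RGT_0; lra.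
  - rewrite tech5, IH, Hstep. ring.
Qed.

Lemma sum_inv_squares_le (n : nat) :
  sum_f_R0 (fun k => / INR (S k) ^ 2) n <= PI ^ 2 / 6.
Proof.
  rewrite sum_inv_squares.
  assert (0 <= Jcos (S n) / Icos (S n)); [|lra].
  apply Rdiv_le_0_compat; [apply Jcos_ge0 | apply Icos_pos].
Qed.

(** * An upper bound for the product of 1/(1 - x^(2m+1)) *)

Lemma is_derive_log_series (K : nat) (t : R) :
  is_derive (fun t => sum_f_R0 (fun k => t ^ S k / INR (S k)) K) t
            (sum_f_R0 (fun k => t ^ k) K).
Proof.
  induction K as [|K IH].
  - simpl. auto_derive; [exact I|]. field.
  - apply (is_derive_ext
      (fun t => plus (sum_f_R0 (fun k => t ^ S k / INR (S k)) K) (t ^ S (S K) / INR (S (S K)))));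
      [reflexivity|].
    rewrite tech5. apply (is_derive_plus (V := R_NormedModule)); [exact IH|].
    assert (H : INR (S (S K)) <> 0) by (apply not_0_INR; lia).
    auto_derive; [exact I|].
    change (1 * (INR (S (S K)) * t ^ S K) * / INR (S (S K)) = t ^ S K).
    field. exact H.
Qed.

Lemma pow_div_le (t y : R) (K : nat) :
  0 <= t <= y -> y < 1 -> t ^ K / (1 - t) <= y ^ K / (1 - y).
Proof.
  intros Ht Hy. unfold Rdiv. apply Rmult_le_compat.
  - apply pow_le; lra.
  - left; apply Rinv_0_lt_compat; lra.
  - apply pow_incr; lra.
  - apply Rinv_le_contravar; lra.
Qed.

(** The difference of the two sides, with the remainder scaled linearly in t, vanishes at t = 0 and
    has derivative y^(K+1)/(1-y) - t^(K+1)/(1-t), which is nonnegative on [0, y]. The explicit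
    remainder keeps all later sums finite. *)
Lemma neg_ln_le (y : R) (K : nat) : 0 <= y < 1 ->
  - ln (1 - y) <= sum_f_R0 (fun k => y ^ S k / INR (S k)) K + y ^ S K / (1 - y).
Proof.
  intros Hy.
  set (h t := sum_f_R0 (fun k => t ^ S k / INR (S k)) K + (ln (1 - t) + t * (y ^ S K / (1 - y)))).
  set (dh t := sum_f_R0 (fun k => t ^ k) K + (- / (1 - t) + y ^ S K / (1 - y))).
  assert (Hd : forall t, 0 <= t <= y -> is_derive h t (dh t)).
  { intros t Ht. apply (is_derive_plus (V := R_NormedModule)); [apply is_derive_log_series|].
    generalize (y ^ S K / (1 - y)); intros r. auto_derive; [lra|]. field. lra. }
  destruct (MVT_gen h 0 y dh) as [c [Hc Heq]].
  - intros t. rewrite Rmin_left, Rmax_right by lra. intros Ht. apply Hd; lra.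
  - intros t. rewrite Rmin_left, Rmax_right by lra. intros Ht.
    apply continuity_pt_filterlim, (ex_derive_continuous (V := R_NormedModule)).
    eexists; apply Hd; lra.
  - rewrite Rmin_left, Rmax_right in Hc by lra.
    assert (Hdc : 0 <= dh c).
    { unfold dh. rewrite tech3 by lra.
      assert (H := pow_div_le c y (S K) Hc (proj2 Hy)).
      replace ((1 - c ^ S K) / (1 - c)) with (/ (1 - c) - c ^ S K / (1 - c)) by (field; lra).
      lra. }
    assert (H0 : h 0 = 0).
    { unfold h. rewrite Rminus_0_r, ln_1.
      rewrite (sum_eq_R0 (fun k => 0 ^ S k / INR (S k)) K); [ring|].
      intros k _. rewrite pow_i by lia. unfold Rdiv; ring. }
    rewrite H0 in Heq.
    assert (Hy0 : 0 <= h y) by (assert (0 <= dh c * (y - 0)) by (apply Rmult_le_pos; lra); lra).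
    unfold h in Hy0.
    assert (y * (y ^ S K / (1 - y)) <= y ^ S K / (1 - y)); [|lra].
    rewrite <- (Rmult_1_l (y ^ S K / (1 - y))) at 2.
    apply Rmult_le_compat_r; [|lra].
    apply Rdiv_le_0_compat; [apply pow_le|]; lra.
Qed.

Lemma sum_odd_powers_le (y : R) (N : nat) : 0 <= y < 1 ->
  sum_f_R0 (fun m => y ^ (2 * m + 1)) N <= y / (1 - y ^ 2).
Proof.
  intros Hy. assert (Hy2 : 0 <= y ^ 2 < 1) by nra.
  replace (sum_f_R0 _ N) with (y * ((1 - (y ^ 2) ^ S N) / (1 - y ^ 2))).
  - unfold Rdiv. apply Rmult_le_compat_l; [lra|].
    rewrite <- (Rmult_1_l (/ (1 - y ^ 2))) at 2. apply Rmult_le_compat_r.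
    + left; apply Rinv_0_lt_compat; lra.
    + assert (0 <= (y ^ 2) ^ S N) by (apply pow_le; lra). lra.
  - rewrite <- tech3 by lra. rewrite scal_sum. apply sum_eq. intros m _.
    rewrite pow_add, pow_mult, pow_1. reflexivity.
Qed.

Lemma sinh_ge (v : R) : 0 <= v -> 2 * v <= exp v - exp (- v).
Proof.
  intros Hv.
  destruct (MVT_gen (fun t => exp t - exp (- t) - 2 * t) 0 v (fun t => exp t + exp (- t) - 2))
    as [c [_ Hc]].
  - intros t _. auto_derive; [exact I|]. ring.
  - intros t _. apply continuity_pt_filterlim,
      (ex_derive_continuous (V := R_NormedModule) (fun t => exp t - exp (- t) - 2 * t)).
    auto_derive. exact I.
  - rewrite Ropp_0 in Hc.
    assert (0 <= exp c + exp (- c) - 2).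
    { rewrite exp_Ropp. assert (H := exp_pos c).
      replace (exp c + / exp c - 2) with ((exp c - 1) ^ 2 / exp c) by (field; lra).
      apply Rdiv_le_0_compat; [apply pow2_ge_0 | exact H]. }
    assert (0 <= (exp c + exp (- c) - 2) * (v - 0)) by (apply Rmult_le_pos; lra). lra.
Qed.

Lemma odd_geometric_le (v : R) : 0 < v ->
  exp (- v) / (1 - exp (- v) ^ 2) <= / (2 * v).
Proof.
  intros Hv. assert (H := exp_neg_lt_1 v Hv). assert (Hs := sinh_ge v (Rlt_le _ _ Hv)).
  assert (Hp := exp_pos v). rewrite exp_Ropp in *.
  replace (/ exp v / (1 - (/ exp v) ^ 2)) with (/ (exp v - / exp v)).
  - apply Rinv_le_contravar; lra.
  - assert (1 < exp v) by (rewrite <- exp_0; apply exp_increasing; lra).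
    field. split; [lra | nra].
Qed.

(** Each logarithm is expanded to order [K] and the two finite sums are exchanged. As x^(2m+1) <= x,
    every remainder is at most that of x itself, so the total error tends to 0 as [K] grows with [N]
    fixed. *)
Lemma sum_neg_ln_odd_aux (x : R) (K N : nat) : 0 <= x < 1 ->
  sum_f_R0 (fun m => - ln (1 - x ^ (2 * m + 1))) N <=
  sum_f_R0 (fun k => sum_f_R0 (fun m => (x ^ S k) ^ (2 * m + 1)) N / INR (S k)) K
  + INR (S N) * (x ^ S K / (1 - x)).
Proof.
  intros Hx.
  assert (Hterm : forall m, - ln (1 - x ^ (2 * m + 1)) <=
     sum_f_R0 (fun k => (x ^ S k) ^ (2 * m + 1) / INR (S k)) K + x ^ S K / (1 - x)).
  { intros m.
    assert (Hxm : 0 <= x ^ (2 * m + 1) <= x).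
    { rewrite Nat.add_1_r. apply pow_S_bounds, Hx. }
    eapply Rle_trans; [apply (neg_ln_le _ K); lra|].
    apply Rplus_le_compat.
    - right. apply sum_eq. intros k _. rewrite <- !pow_mult. do 2 f_equal. lia.
    - apply pow_div_le; lra. }
  induction N as [|N IH].
  - change (sum_f_R0 _ 0) with (- ln (1 - x ^ (2 * 0 + 1))) at 1.
    rewrite Rmult_1_l. apply Hterm.
  - rewrite tech5.
    eapply Rle_trans; [apply Rplus_le_compat; [apply IH | apply Hterm]|].
    right. rewrite (S_INR (S N)).
    rewrite (sum_eq
      (fun k => sum_f_R0 (fun m => (x ^ S k) ^ (2 * m + 1)) (S N) / INR (S k))
      (fun k => sum_f_R0 (fun m => (x ^ S k) ^ (2 * m + 1)) N / INR (S k)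
       + (x ^ S k) ^ (2 * S N + 1) / INR (S k)) K)
      by (intros k _; rewrite tech5; unfold Rdiv; ring).
    rewrite plus_sum. ring.
Qed.

Lemma sum_neg_ln_odd_le (u : R) (N : nat) : 0 < u ->
  sum_f_R0 (fun m => - ln (1 - exp (- u) ^ (2 * m + 1))) N <= PI ^ 2 / (12 * u).
Proof.
  intros Hu. set (x := exp (- u)). assert (Hx : 0 < x < 1) by (apply exp_neg_lt_1, Hu).
  assert (HK : forall K, sum_f_R0 (fun m => - ln (1 - x ^ (2 * m + 1))) N
     <= PI ^ 2 / (12 * u) + (INR (S N) * x / (1 - x)) * x ^ K).
  { intros K. eapply Rle_trans; [apply (sum_neg_ln_odd_aux x K N); lra|].
    apply Rplus_le_compat; [|right; simpl pow; unfold Rdiv; ring].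
    (* For fixed k the sum over odd exponents is at most 1/(2ku); the factor 1/k of the logarithm
       series turns this into 1/(2u) times 1/k^2. *)
    apply Rle_trans with (/ (2 * u) * sum_f_R0 (fun k => / INR (S k) ^ 2) K).
    - rewrite scal_sum. apply sum_Rle. intros k _.
      assert (Hk : 0 < INR (S k)) by (apply lt_0_INR; lia).
      assert (Hxk : x ^ S k = exp (- (INR (S k) * u))).
      { unfold x. rewrite exp_pow. f_equal; ring. }
      assert (Hv : 0 < INR (S k) * u) by (apply Rmult_lt_0_compat; lra).
      replace (/ INR (S k) ^ 2 * / (2 * u)) with (/ (2 * (INR (S k) * u)) / INR (S k))
        by (field; lra).
      unfold Rdiv. apply Rmult_le_compat_r; [left; apply Rinv_0_lt_compat, Hk|].
      rewrite Hxk. eapply Rle_trans; [apply sum_odd_powers_le|apply odd_geometric_le, Hv].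
      destruct (exp_neg_lt_1 _ Hv); lra.
    - replace (PI ^ 2 / (12 * u)) with (/ (2 * u) * (PI ^ 2 / 6)) by (field; lra).
      apply Rmult_le_compat_l; [|apply sum_inv_squares_le].
      left; apply Rinv_0_lt_compat; lra. }
  apply (is_lim_seq_le (fun _ => sum_f_R0 (fun m => - ln (1 - x ^ (2 * m + 1))) N)
    (fun K => PI ^ 2 / (12 * u) + (INR (S N) * x / (1 - x)) * x ^ K)
    (sum_f_R0 (fun m => - ln (1 - x ^ (2 * m + 1))) N) (PI ^ 2 / (12 * u)) HK).
  - apply is_lim_seq_const.
  - replace (Finite (PI ^ 2 / (12 * u)))
      with (Finite (PI ^ 2 / (12 * u) + (INR (S N) * x / (1 - x)) * 0)) by (f_equal; ring).
    apply is_lim_seq_plus'; [apply is_lim_seq_const|].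
    apply is_lim_seq_mult'; [apply is_lim_seq_const|].
    apply is_lim_seq_geom. rewrite Rabs_pos_eq; lra.
Qed.

(** * Cauchy's estimate *)

Lemma is_series_Re (a : nat -> C) (l : C) :
  is_series (K := C_AbsRing) (V := C_NormedModule) a l ->
  is_series (fun k => Re (a k)) (Re l).
Proof.
  intros H. unfold is_series in *.
  apply (filterlim_ext (fun n => Re (sum_n a n))).
  { intros n. induction n as [|n IH]; [rewrite !sum_O; reflexivity|].
    rewrite !sum_Sn, <- IH. reflexivity. }
  apply (filterlim_comp _ _ _ _ Re _ (locally l) _ H).
  intros P [eps HP]. exists eps. intros y [Hy _]. apply HP, Hy.
Qed.

Lemma Cexp_plus (v w : C) : Cexp (v + w)%C = (Cexp v * Cexp w)%C.
Proof.
  unfold Cexp, Re, Im. destruct v as [a x], w as [b y]. simpl.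
  rewrite exp_plus, cos_plus, sin_plus. unfold Cmult, RtoC; simpl. f_equal; ring.
Qed.

Lemma Cexp_pow (a t : R) (k : nat) :
  (Cexp (a, t) ^ k)%C = Cexp (INR k * a, INR k * t).
Proof.
  induction k as [|k IH].
  - unfold Cexp, Re, Im; simpl. rewrite !Rmult_0_l, exp_0, cos_0, sin_0.
    unfold Cmult, RtoC; simpl. f_equal; ring.
  - rewrite Cpow_S, IH, <- Cexp_plus, S_INR. f_equal. unfold Cplus; simpl. f_equal; ring.
Qed.

Lemma Cmod_Cexp (w : C) : Cmod (Cexp w) = exp (Re w).
Proof.
  unfold Cexp. rewrite Cmod_mult, Cmod_R, Rabs_pos_eq by (left; apply exp_pos).
  unfold Cmod; simpl. rewrite !Rmult_1_r.
  replace (_ + _) with 1 by (generalize (sin2_cos2 (Im w)); unfold Rsqr; lra).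
  rewrite sqrt_1. ring.
Qed.

Lemma series_geometric_tail (T : nat -> R) (v B rho : R) (K : nat) :
  0 < rho < 1 -> (forall k, Rabs (T k) <= B * rho ^ k) -> is_series T v ->
  Rabs (v - sum_n T K) <= B / (1 - rho) * rho ^ K.
Proof.
  intros Hrho HT Hv.
  assert (HB : 0 <= B).
  { assert (H := HT 0%nat). assert (H' := Rabs_pos (T 0%nat)). simpl in H; lra. }
  (* The factor [1 - rho ^ j] is the partial geometric sum; it lets the induction close and is
     dropped afterwards. *)
  assert (Hpart : forall j, Rabs (sum_n T (j + K) - sum_n T K)
                            <= B / (1 - rho) * rho ^ K * (1 - rho ^ j)).
  { intros j. induction j as [|j IH].
    - simpl. rewrite Rminus_diag, Rabs_R0. lra.
    - simpl Nat.add. rewrite sum_Sn.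
      replace (plus (sum_n T (j + K)) (T (S (j + K))) - sum_n T K)
        with ((sum_n T (j + K) - sum_n T K) + T (S (j + K)))
        by (unfold plus; simpl; ring).
      eapply Rle_trans; [apply Rabs_triang|].
      eapply Rle_trans; [apply Rplus_le_compat; [apply IH | apply HT]|].
      assert (Hp : 0 <= B * rho ^ (j + K)) by (apply Rmult_le_pos; [|apply pow_le]; lra).
      replace (B / (1 - rho) * rho ^ K * (1 - rho ^ S j))
        with (B / (1 - rho) * rho ^ K * (1 - rho ^ j) + B * rho ^ (j + K))
        by (rewrite pow_add; simpl pow; field; lra).
      simpl pow. nra. }
  apply (is_lim_seq_le (fun j => Rabs (sum_n T (j + K) - sum_n T K))
    (fun _ => B / (1 - rho) * rho ^ K) (Rabs (v - sum_n T K)) (B / (1 - rho) * rho ^ K)).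
  - intros j. eapply Rle_trans; [apply Hpart|].
    assert (0 <= B / (1 - rho) * rho ^ K).
    { apply Rmult_le_pos; [apply Rdiv_le_0_compat; lra | apply pow_le; lra]. }
    assert (0 < rho ^ j) by (apply pow_lt; lra). nra.
  - apply (is_lim_seq_abs _ (v - sum_n T K)).
    apply is_lim_seq_minus'; [|apply is_lim_seq_const].
    apply (is_lim_seq_incr_n (sum_n T) K v). exact Hv.
  - apply is_lim_seq_const.
Qed.

(** Orthogonality of the exponentials in real form: an integer frequency k - n other than 0
    integrates to 0 over a full period. The case [K < n] is included so that induction on [K] can
    pass through n. *)
Lemma is_RInt_trig_polynomial (T : nat -> R) (n K : nat) :
  is_RInt (fun t => sum_n (fun k => T k * cos ((INR k - INR n) * t)) K) 0 (2 * PI)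
    (if (n <=? K)%nat then 2 * PI * T n else 0).
Proof.
  assert (Hterm : forall k, is_RInt (fun t => T k * cos ((INR k - INR n) * t)) 0 (2 * PI)
            (if (k =? n)%nat then 2 * PI * T n else 0)).
  { intros k. destruct (Nat.eqb_spec k n) as [->|Hkn].
    - apply (is_RInt_ext (fun _ => T n)).
      + intros t _. rewrite Rminus_diag, Rmult_0_l, cos_0. symmetry; apply Rmult_1_r.
      + replace (2 * PI * T n) with (scal (2 * PI - 0) (T n))
          by (unfold scal; simpl; unfold mult; simpl; ring).
        apply (is_RInt_const (V := R_NormedModule)).
    - assert (Hd : INR k - INR n <> 0) by (intros H; apply Hkn, INR_eq; lra).
      set (F t := T k * sin ((INR k - INR n) * t) / (INR k - INR n)).
      replace 0 with (minus (F (2 * PI)) (F 0)) at 2.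
      + apply (is_RInt_derive (V := R_CompleteNormedModule) F).
        * intros t _. unfold F. auto_derive; [exact I|]. field. exact Hd.
        * intros t _. apply (ex_derive_continuous (V := R_NormedModule)
            (fun t => T k * cos ((INR k - INR n) * t))). auto_derive. exact I.
      + unfold F, minus, plus, opp; simpl.
        replace (sin ((INR k - INR n) * (2 * PI))) with 0.
        * rewrite (Rmult_0_r (INR k - INR n)), sin_0. field. exact Hd.
        * symmetry. rewrite !INR_IZR_INZ, <- minus_IZR. apply sin_eq_0_1.
          exists (2 * (Z.of_nat k - Z.of_nat n))%Z. rewrite mult_IZR. ring. }
  induction K as [|K IH].
  - apply (is_RInt_ext (fun t => T 0%nat * cos ((INR 0 - INR n) * t))).
    { intros t _. rewrite sum_O. reflexivity. }
    assert (H := Hterm 0%nat). destruct n; exact H.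
  - apply (is_RInt_ext (fun t => plus (sum_n (fun k => T k * cos ((INR k - INR n) * t)) K)
        (T (S K) * cos ((INR (S K) - INR n) * t)))).
    { intros t _. rewrite sum_Sn. reflexivity. }
    assert (H := is_RInt_plus (V := R_NormedModule) _ _ _ _ _ _ IH (Hterm (S K))).
    assert (E : (if (n <=? K)%nat then 2 * PI * T n else 0)
                + (if (S K =? n)%nat then 2 * PI * T n else 0)
                = if (n <=? S K)%nat then 2 * PI * T n else 0).
    { destruct (Nat.leb_spec n K), (Nat.eqb_spec (S K) n), (Nat.leb_spec n (S K));
        try lia; ring. }
    exact (eq_ind _ (is_RInt _ 0 (2 * PI)) H _ E).
Qed.

(* [a] is the logarithm of the radius. The power series is truncated, so that
   only a trigonometric polynomial has to be integrated; convergence at the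
   radius exp (a/2) controls the tail. *)
Lemma cauchy_estimate (c : nat -> R) (M : R -> R) (a : R) (n : nat) :
  (forall a t, a < 0 -> exists l : C,
     is_series (K := C_AbsRing) (V := C_NormedModule)
       (fun k => (c k * Cexp (a, t) ^ k)%C) l /\ Cmod l <= M a) ->
  a < 0 -> Rabs (c n) * exp (INR n * a) <= M a.
Proof.
  intros H Ha.
  (* Multiplying the sum by exp (-int) preserves its modulus; as the coefficients are real, taking
     real parts leaves a cosine series bounded by [M a]. *)
  assert (Hreal : forall a t, a < 0 -> exists v,
    is_series (fun k => c k * exp (INR k * a) * cos ((INR k - INR n) * t)) v
    /\ Rabs v <= M a).
  { intros a' t Ha'. destruct (H a' t Ha') as [l [Hl Hb]].
    exists (Re (Cexp (0, (- INR n * t)%R) * l)%C). split.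
    - apply (is_series_ext
        (fun k => Re (Cexp (0, (- INR n * t)%R) * (c k * Cexp (a', t) ^ k))%C)).
      + intros k. rewrite Cexp_pow.
        replace (Cexp (0, (- INR n * t)%R) * (c k * Cexp ((INR k * a')%R, (INR k * t)%R)))%C
          with (c k * Cexp ((0, (- INR n * t)%R) + ((INR k * a')%R, (INR k * t)%R)))%C
          by (rewrite Cexp_plus; ring).
        unfold Cexp, Cplus, Cmult, RtoC, Re, Im; simpl.
        replace (- INR n * t + INR k * t) with ((INR k - INR n) * t) by ring.
        rewrite Rplus_0_l. ring.
      + apply is_series_Re.
        apply (is_series_scal (K := C_AbsRing) (V := C_NormedModule)). exact Hl.
    - eapply Rle_trans; [|exact Hb].
      rewrite <- (Rmult_1_l (Cmod l)), <- exp_0.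
      change 0 with (Re (0, (- INR n * t)%R)) at 2. rewrite <- Cmod_Cexp, <- Cmod_mult.
      eapply Rle_trans; [apply Rmax_l | apply Rmax_Cmod]. }
  (* As a < 0, exp (a/2) is a larger radius. At angle 0 the terms there are real, tend to 0 and
     hence are bounded, which makes those at radius exp a decay like [exp (a / 2) ^ k]. *)
  assert (Hbd : exists B, forall k, Rabs (c k * exp (INR k * a)) <= B * exp (a / 2) ^ k).
  { destruct (H (a / 2) 0) as [l [Hl _]]; [lra|].
    apply is_series_Re in Hl.
    assert (Hlim := ex_series_lim_0 _ (ex_intro _ _ Hl)).
    destruct (filterlim_bounded (V := R_NormedModule)
      (fun k => Re (c k * Cexp ((a / 2)%R, 0) ^ k)%C) (ex_intro _ 0 Hlim)) as [B HB].
    exists B. intros k. specialize (HB k).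
    rewrite Cexp_pow in HB.
    rewrite exp_pow. replace (INR k * a) with (INR k * (a / 2) + INR k * (a / 2)) by field.
    rewrite exp_plus, <- Rmult_assoc, Rabs_mult, (Rabs_pos_eq (exp _)) by (left; apply exp_pos).
    apply Rmult_le_compat_r; [left; apply exp_pos|].
    eapply Rle_trans; [|exact HB]. right. unfold norm; simpl. unfold abs; simpl.
    f_equal. unfold Re, Im; simpl. rewrite Rmult_0_r, cos_0. ring. }
  destruct Hbd as [B HB].
  assert (Hrho : 0 < exp (a / 2) < 1).
  { split; [apply exp_pos|]. rewrite <- exp_0. apply exp_increasing; lra. }
  set (rho := exp (a / 2)) in *.
  assert (Htrunc : forall K t,
    Rabs (sum_n (fun k => c k * exp (INR k * a) * cos ((INR k - INR n) * t)) K)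
    <= M a + B / (1 - rho) * rho ^ K).
  { intros K t. destruct (Hreal a t Ha) as [v [Hv Hvb]].
    assert (Hd : Rabs (v - sum_n (fun k => c k * exp (INR k * a) * cos ((INR k - INR n) * t)) K)
                 <= B / (1 - rho) * rho ^ K).
    { apply series_geometric_tail; [exact Hrho| |exact Hv]. intros k. rewrite Rabs_mult.
      eapply Rle_trans; [|apply HB]. rewrite <- (Rmult_1_r (Rabs (c k * _))) at 2.
      apply Rmult_le_compat_l; [apply Rabs_pos|]. apply Rabs_le, COS_bound. }
    apply Rabs_le_between in Hd. apply Rabs_le_between in Hvb. apply Rabs_le. lra. }
  assert (HK : forall K, Rabs (c n) * exp (INR n * a) <= M a + B / (1 - rho) * rho ^ (K + n)).
  { intros K. assert (HI := is_RInt_trig_polynomial (fun k => c k * exp (INR k * a)) n (K + n)).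
    rewrite (proj2 (Nat.leb_le n (K + n))) in HI by lia.
    assert (Hpi := PI_RGT_0).
    assert (Hc : forall y, is_RInt (fun _ => y) 0 (2 * PI) (2 * PI * y)).
    { intros y. replace (2 * PI * y) with (scal (2 * PI - 0) y)
        by (unfold scal; simpl; unfold mult; simpl; ring).
      apply (is_RInt_const (V := R_NormedModule)). }
    set (E := M a + B / (1 - rho) * rho ^ (K + n)) in *.
    assert (Hup := is_RInt_le _ _ _ _ _ _ (ltac:(lra) : 0 <= 2 * PI) HI (Hc E)
      (fun t _ => proj2 (proj1 (Rabs_le_between _ _) (Htrunc (K + n)%nat t)))).
    assert (Hlo := is_RInt_le _ _ _ _ _ _ (ltac:(lra) : 0 <= 2 * PI) (Hc (- E)) HI
      (fun t _ => proj1 (proj1 (Rabs_le_between _ _) (Htrunc (K + n)%nat t)))).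
    rewrite <- (Rabs_pos_eq (exp (INR n * a))) by (left; apply exp_pos).
    rewrite <- Rabs_mult. apply Rabs_le.
    split; apply (Rmult_le_reg_l (2 * PI)); lra. }
  apply (is_lim_seq_le (fun _ => Rabs (c n) * exp (INR n * a))
    (fun K => M a + B / (1 - rho) * rho ^ (K + n)) (Rabs (c n) * exp (INR n * a)) (M a) HK).
  - apply is_lim_seq_const.
  - replace (Finite (M a)) with (Finite (M a + B / (1 - rho) * 0)) by (f_equal; ring).
    apply is_lim_seq_plus'; [apply is_lim_seq_const|].
    apply is_lim_seq_mult'; [apply is_lim_seq_const|].
    apply (is_lim_seq_incr_n (fun K => rho ^ K) n 0), is_lim_seq_geom.
    rewrite Rabs_pos_eq; lra.
Qed.

(** * The infinite product and the size of psi and phi *)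

Lemma Cmod_1_minus_le (w : C) : Cmod (1 - w)%C <= 1 + Cmod w.
Proof.
  unfold Cminus. eapply Rle_trans; [apply Cmod_triangle|]. rewrite Cmod_1, Cmod_opp. lra.
Qed.

Lemma Cmod_1_minus_ge (w : C) : 1 - Cmod w <= Cmod (1 - w)%C.
Proof.
  assert (H := Cmod_triangle (1 - w) w).
  replace (1 - w + w)%C with (RtoC 1) in H by ring. rewrite Cmod_1 in H. lra.
Qed.

(** Used with k = 24: each factor of the product differs from 1 by a constant times |q|^n, which
    gives absolute convergence. *)
Lemma Cmod_pow_1_minus_sub_1 (k : nat) : exists c, forall w, Cmod w <= 1 ->
  Cmod ((1 - w) ^ k - 1)%C <= c * Cmod w.
Proof.
  induction k as [|k [c IH]].
  - exists 0. intros w _. simpl. replace (1 - 1)%C with (RtoC 0) by ring.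
    rewrite Cmod_0. lra.
  - exists (2 * c + 1). intros w Hw.
    replace ((1 - w) ^ S k - 1)%C with (((1 - w) ^ k - 1) * (1 - w) + - w)%C by (simpl; ring).
    eapply Rle_trans; [apply Cmod_triangle|]. rewrite Cmod_mult, Cmod_opp.
    assert (H1 := Cmod_1_minus_le w). assert (H2 := IH w Hw).
    assert (H3 := Cmod_ge_0 (1 - w)). assert (H4 := Cmod_ge_0 ((1 - w) ^ k - 1)).
    assert (Cmod ((1 - w) ^ k - 1) * Cmod (1 - w) <= (c * Cmod w) * 2)
      by (apply Rmult_le_compat; lra).
    lra.
Qed.

(** The partial products of [Delta] without the leading factor q, as functions of q alone, so that z
    and 2z correspond to q and q * q. *)
Definition eta_prod (q : C) (N : nat) : C := Cprod1 (fun n => (1 - q ^ n) ^ 24)%C N.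

Definition eta_inf (q : C) : C := Cprod1_inf (fun n => (1 - q ^ n) ^ 24)%C.

Lemma eta_prod_upper (q : C) (N : nat) : Cmod q < 1 ->
  Cmod (eta_prod q N) <= exp (24 * (Cmod q * (1 - Cmod q ^ N) / (1 - Cmod q))).
Proof.
  intros Hq. assert (H0 := Cmod_ge_0 q).
  unfold eta_prod. induction N as [|N IH].
  - simpl. rewrite Cmod_1. right. rewrite <- exp_0 at 1. f_equal. field. lra.
  - cbn [Cprod1]. rewrite Cmod_mult.
    replace (24 * (Cmod q * (1 - Cmod q ^ S N) / (1 - Cmod q)))
      with (24 * (Cmod q * (1 - Cmod q ^ N) / (1 - Cmod q)) + INR 24 * Cmod q ^ S N)
      by (simpl INR; simpl pow; field; lra).
    rewrite exp_plus, <- exp_pow, Cmod_pow.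
    apply Rmult_le_compat; [apply Cmod_ge_0 | apply pow_le, Cmod_ge_0 | exact IH|].
    apply pow_incr. split; [apply Cmod_ge_0|].
    eapply Rle_trans; [apply Cmod_1_minus_le|]. rewrite Cmod_pow. apply exp_ineq1_le.
Qed.

(** The bound is crude but does not depend on [N], so the limit cannot be 0. It rests on 1 - y >=
    exp (- y / (1 - x)) for 0 <= y <= x < 1, applied with x = |q| and y = x^n, and on a geometric
    sum. *)
Lemma eta_prod_lower (q : C) (N : nat) : Cmod q < 1 ->
  exp (- (24 * (Cmod q / (1 - Cmod q) ^ 2))) <= Cmod (eta_prod q N).
Proof.
  intros Hq. assert (H0 := Cmod_ge_0 q).
  apply Rle_trans with (exp (- (24 * (Cmod q * (1 - Cmod q ^ N) / (1 - Cmod q) ^ 2)))).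
  - assert (Hp : 0 <= Cmod q ^ N) by (apply pow_le; lra).
    assert (H : Cmod q * (1 - Cmod q ^ N) / (1 - Cmod q) ^ 2 <= Cmod q / (1 - Cmod q) ^ 2).
    { unfold Rdiv. apply Rmult_le_compat_r; [|nra].
      left. apply Rinv_0_lt_compat, pow_lt. lra. }
    apply exp_monotone. lra.
  - unfold eta_prod. induction N as [|N IH].
    + cbn [Cprod1]. rewrite Cmod_1. right. symmetry.
      rewrite <- exp_0 at 1. f_equal. simpl pow. field. lra.
    + cbn [Cprod1]. rewrite Cmod_mult.
      replace (- (24 * (Cmod q * (1 - Cmod q ^ S N) / (1 - Cmod q) ^ 2)))
        with (- (24 * (Cmod q * (1 - Cmod q ^ N) / (1 - Cmod q) ^ 2))
              + INR 24 * - (Cmod q ^ S N / (1 - Cmod q)))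
        by (simpl INR; simpl pow; field; lra).
      rewrite exp_plus, <- exp_pow, Cmod_pow.
      apply Rmult_le_compat; [left; apply exp_pos | apply pow_le; left; apply exp_pos | exact IH|].
      apply pow_incr. split; [left; apply exp_pos|].
      eapply Rle_trans; [|apply Cmod_1_minus_ge]. rewrite Cmod_pow.
      destruct (pow_S_bounds (Cmod q) N) as [Hy0 Hy1]; [lra|].
      set (y := Cmod q ^ S N) in *.
      rewrite exp_Ropp.
      (* From exp t >= 1 + t with t = y/(1-x); the remaining claim 1 - x <= (1-y)(1-x+y) amounts to
         y(x-y) >= 0. *)
      apply Rle_trans with (/ (1 + y / (1 - Cmod q))).
      * apply Rinv_le_contravar; [|apply exp_ineq1_le].
        assert (0 <= y / (1 - Cmod q)) by (apply Rdiv_le_0_compat; lra). lra.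
      * replace (/ (1 + y / (1 - Cmod q))) with ((1 - Cmod q) / (1 - Cmod q + y)) by (field; lra).
        apply (Rmult_le_reg_r (1 - Cmod q + y)); [lra|].
        replace ((1 - Cmod q) / (1 - Cmod q + y) * (1 - Cmod q + y)) with (1 - Cmod q)
          by (field; lra).
        nra.
Qed.

(** The product is turned into the series of its successive differences, dominated by a geometric
    series; the empty product 1 accounts for the limit [D + 1]. The real module structure on C is
    the one in which [Cprod1_inf] takes its limit. *)
Lemma eta_prod_converges (q : C) : Cmod q < 1 ->
  exists L, filterlim (eta_prod q) eventually
    (locally (T := NormedModule.UniformSpace R_AbsRing C_R_NormedModule) L).
Proof.
  intros Hq. assert (H0 := Cmod_ge_0 q).
  destruct (Cmod_pow_1_minus_sub_1 24) as [c Hc].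
  set (A := exp (24 * (Cmod q / (1 - Cmod q)))).
  assert (Hd : ex_series (K := R_AbsRing) (V := C_R_CompleteNormedModule)
                 (fun N => eta_prod q (S N) - eta_prod q N)%C).
  { apply (ex_series_le (K := R_AbsRing) (V := C_R_CompleteNormedModule)
      _ (fun N => A * c * Cmod q * Cmod q ^ N)).
    - intros N.
      replace (norm _) with (Cmod (eta_prod q (S N) - eta_prod q N)) by apply Cmod_norm.
      change (eta_prod q (S N)) with (eta_prod q N * (1 - q ^ S N) ^ 24)%C.
      replace (eta_prod q N * (1 - q ^ S N) ^ 24 - eta_prod q N)%C
        with (eta_prod q N * ((1 - q ^ S N) ^ 24 - 1))%C by ring.
      rewrite Cmod_mult. rewrite !Rmult_assoc.
      apply Rmult_le_compat; try apply Cmod_ge_0.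
      + eapply Rle_trans; [apply eta_prod_upper, Hq|].
        assert (Hp : 0 <= Cmod q ^ N) by (apply pow_le; lra).
        assert (H : Cmod q * (1 - Cmod q ^ N) / (1 - Cmod q) <= Cmod q / (1 - Cmod q)).
        { unfold Rdiv. apply Rmult_le_compat_r; [|nra].
          left. apply Rinv_0_lt_compat. lra. }
        apply exp_monotone. lra.
      + destruct (pow_S_bounds (Cmod q) N) as [Hy0 Hy1]; [lra|].
        rewrite <- Cmod_pow in Hy1. eapply Rle_trans; [apply Hc; lra|].
        rewrite Cmod_pow. simpl pow. lra.
    - apply (ex_series_scal (K := R_AbsRing) (V := R_NormedModule)
        (A * c * Cmod q) (fun N => Cmod q ^ N)).
      apply ex_series_geom. rewrite Rabs_pos_eq; lra. }
  destruct Hd as [D HD]. exists (D + 1)%C.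
  assert (Hsum : forall N, eta_prod q (S N)
     = plus (G := C_R_NormedModule)
         (sum_n (G := C_R_NormedModule) (fun N => eta_prod q (S N) - eta_prod q N)%C N)
         (RtoC 1)).
  { intros N. induction N as [|N IH].
    - rewrite sum_O. change (eta_prod q 0) with (RtoC 1).
      change (eta_prod q 1 = (eta_prod q 1 - 1 + 1)%C). ring.
    - rewrite sum_Sn.
      change (eta_prod q (S (S N)) =
        (sum_n (G := C_R_NormedModule) (fun N => eta_prod q (S N) - eta_prod q N)%C N
          + (eta_prod q (S (S N)) - eta_prod q (S N)) + 1)%C).
      rewrite IH.
      change (plus (G := C_R_NormedModule)) with Cplus. ring. }
  intros P HP.
  assert (HS : filterlim (fun N => eta_prod q (S N)) eventually
    (locally (T := NormedModule.UniformSpace R_AbsRing C_R_NormedModule) (D + 1)%C)).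
  { eapply filterlim_ext; [intros N; symmetry; apply Hsum|].
    eapply filterlim_comp_2; [exact HD | apply filterlim_const | ].
    apply (filterlim_plus (K := R_AbsRing) (V := C_R_NormedModule) D (RtoC 1)). }
  destruct (HS P HP) as [N0 HN0]. exists (S N0). intros [|n] Hn; [lia|].
  apply HN0. lia.
Qed.

Lemma eta_inf_lim (q : C) : Cmod q < 1 ->
  is_lim_seq (fun N => Cmod (eta_prod q N)) (Cmod (eta_inf q)).
Proof.
  intros Hq. destruct (eta_prod_converges q Hq) as [L HL].
  assert (E : filterlim (eta_prod q) eventually
    (locally (T := NormedModule.UniformSpace R_AbsRing C_R_NormedModule) (eta_inf q))).
  { apply filterlim_locally. intros eps.
    apply (complete_cauchy (T := C_R_CompleteNormedModule) (filtermap (eta_prod q) eventually)).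
    - apply filtermap_proper_filter. apply eventually_filter.
    - intros eta. exists L. apply HL. exists eta. intros y Hy; exact Hy. }
  apply (filterlim_ext (fun N => norm (K := R_AbsRing) (V := C_R_NormedModule) (eta_prod q N))).
  { intros N. symmetry. apply Cmod_norm. }
  rewrite Cmod_norm.
  eapply filterlim_comp; [exact E|].
  apply (filterlim_norm (K := R_AbsRing) (V := C_R_NormedModule)).
Qed.

Lemma eta_inf_pos (q : C) : Cmod q < 1 -> 0 < Cmod (eta_inf q).
Proof.
  intros Hq.
  apply Rlt_le_trans with (exp (- (24 * (Cmod q / (1 - Cmod q) ^ 2)))); [apply exp_pos|].
  apply (is_lim_seq_le (fun _ => exp (- (24 * (Cmod q / (1 - Cmod q) ^ 2))))
    (fun N => Cmod (eta_prod q N)) (exp (- (24 * (Cmod q / (1 - Cmod q) ^ 2)))) (Cmod (eta_inf q))).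
  - intros N. apply eta_prod_lower, Hq.
  - apply is_lim_seq_const.
  - apply eta_inf_lim, Hq.
Qed.

(** * Comparison of the products at q and at q * q *)

Definition odd_prod (q : C) (N : nat) : C := Cprod1 (fun m => 1 - q ^ (2 * m - 1))%C N.

(** Even exponents give the product at q * q and odd ones the rest: the finite form of the quotient
    Delta(z)/Delta(2z). *)
Lemma eta_prod_split (q : C) (N : nat) :
  eta_prod q (2 * N) = (eta_prod (q * q) N * odd_prod q N ^ 24)%C.
Proof.
  induction N as [|N IH].
  - unfold eta_prod, odd_prod; simpl. ring.
  - replace (2 * S N)%nat with (S (S (2 * N))) by lia.
    unfold eta_prod, odd_prod in *. cbn [Cprod1]. rewrite IH.
    replace (2 * S N - 1)%nat with (S (2 * N)) by lia.
    replace (S (S (2 * N))) with (S N + S N)%nat by lia.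
    rewrite !Cpow_mult_l, Cpow_add_r. ring.
Qed.

Lemma odd_prod_upper (q : C) (N : nat) : Cmod q < 1 ->
  Cmod (odd_prod q (S N)) <= exp (Cmod q / (1 - Cmod q ^ 2)).
Proof.
  intros Hq. assert (H0 := Cmod_ge_0 q).
  apply Rle_trans with (exp (sum_f_R0 (fun m => Cmod q ^ (2 * m + 1)) N)).
  - assert (Hf : forall m, Cmod (1 - q ^ (2 * S m - 1))%C <= exp (Cmod q ^ (2 * m + 1))).
    { intros m. replace (2 * S m - 1)%nat with (2 * m + 1)%nat by lia.
      eapply Rle_trans; [apply Cmod_1_minus_le|]. rewrite Cmod_pow. apply exp_ineq1_le. }
    induction N as [|N IH].
    + unfold odd_prod. cbn [Cprod1]. rewrite Cmult_1_l. apply (Hf 0%nat).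
    + rewrite tech5, exp_plus. unfold odd_prod in *.
      change (Cprod1 (fun m => (1 - q ^ (2 * m - 1))%C) (S (S N)))
        with (Cprod1 (fun m => (1 - q ^ (2 * m - 1))%C) (S N) * (1 - q ^ (2 * S (S N) - 1)))%C.
      rewrite Cmod_mult.
      apply Rmult_le_compat; [apply Cmod_ge_0 | apply Cmod_ge_0 | exact IH | apply (Hf (S N))].
  - apply exp_monotone, sum_odd_powers_le. lra.
Qed.

Lemma odd_prod_lower (q : C) (u : R) (N : nat) : 0 < u -> Cmod q = exp (- u) ->
  exp (- (PI ^ 2 / (12 * u))) <= Cmod (odd_prod q (S N)).
Proof.
  intros Hu Hq. assert (Hx := exp_neg_lt_1 u Hu).
  apply Rle_trans with (exp (- sum_f_R0 (fun m => - ln (1 - exp (- u) ^ (2 * m + 1))) N)).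
  - apply exp_monotone, Ropp_le_contravar, sum_neg_ln_odd_le, Hu.
  - assert (Hf : forall m,
      exp (- - ln (1 - exp (- u) ^ (2 * m + 1))) <= Cmod (1 - q ^ (2 * S m - 1))%C).
    { intros m. replace (2 * S m - 1)%nat with (2 * m + 1)%nat by lia.
      rewrite Ropp_involutive. rewrite exp_ln.
      - rewrite <- Hq, <- Cmod_pow. apply Cmod_1_minus_ge.
      - rewrite Nat.add_1_r. destruct (pow_S_bounds (exp (- u)) (2 * m)); lra. }
    induction N as [|N IH].
    + unfold odd_prod. cbn [Cprod1]. rewrite Cmult_1_l. apply (Hf 0%nat).
    + rewrite tech5, Ropp_plus_distr, exp_plus. unfold odd_prod in *.
      change (Cprod1 (fun m => (1 - q ^ (2 * m - 1))%C) (S (S N)))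
        with (Cprod1 (fun m => (1 - q ^ (2 * m - 1))%C) (S N) * (1 - q ^ (2 * S (S N) - 1)))%C.
      rewrite Cmod_mult.
      apply Rmult_le_compat; [left; apply exp_pos | left; apply exp_pos | exact IH | apply (Hf (S N))].
Qed.

Lemma is_lim_seq_eta_double (q : C) : Cmod q < 1 ->
  is_lim_seq (fun N => Cmod (eta_prod q (2 * S N))) (Cmod (eta_inf q)).
Proof.
  intros Hq.
  apply (is_lim_seq_subseq (fun N => Cmod (eta_prod q N)) _ (fun N => (2 * S N)%nat)).
  - apply eventually_subseq. intros n. lia.
  - apply eta_inf_lim, Hq.
Qed.

Lemma Cmod_square_lt_1 (q : C) : Cmod q < 1 -> Cmod (q * q)%C < 1.
Proof. intros Hq. rewrite Cmod_mult. assert (H := Cmod_ge_0 q). nra. Qed.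

Lemma eta_inf_le (q : C) : Cmod q < 1 ->
  Cmod (eta_inf q) <= exp (24 * (Cmod q / (1 - Cmod q ^ 2))) * Cmod (eta_inf (q * q)).
Proof.
  intros Hq. set (B := exp _).
  apply (is_lim_seq_le (fun N => Cmod (eta_prod q (2 * S N)))
    (fun N => B * Cmod (eta_prod (q * q) (S N))) (Cmod (eta_inf q)) (B * Cmod (eta_inf (q * q)))).
  - intros N. rewrite eta_prod_split, Cmod_mult, Rmult_comm.
    apply Rmult_le_compat_r; [apply Cmod_ge_0|]. rewrite Cmod_pow.
    unfold B. replace 24 with (INR 24) by (simpl; ring). rewrite <- exp_pow.
    apply pow_incr. split; [apply Cmod_ge_0 | apply odd_prod_upper, Hq].
  - apply is_lim_seq_eta_double, Hq.
  - apply is_lim_seq_mult'; [apply is_lim_seq_const|].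
    apply (is_lim_seq_incr_1 (fun N => Cmod (eta_prod (q * q) N))).
    apply eta_inf_lim, Cmod_square_lt_1, Hq.
Qed.

Lemma eta_inf_square_le (q : C) (u : R) : 0 < u -> Cmod q = exp (- u) ->
  Cmod (eta_inf (q * q)) <= exp (2 * PI ^ 2 / u) * Cmod (eta_inf q).
Proof.
  intros Hu Hqu. assert (Hx := exp_neg_lt_1 u Hu). assert (Hq : Cmod q < 1) by lra.
  set (B := exp _).
  apply (is_lim_seq_le (fun N => Cmod (eta_prod (q * q) (S N)))
    (fun N => B * Cmod (eta_prod q (2 * S N))) (Cmod (eta_inf (q * q))) (B * Cmod (eta_inf q))).
  - intros N. rewrite eta_prod_split, Cmod_mult.
    rewrite <- (Rmult_1_r (Cmod (eta_prod (q * q) (S N)))) at 1.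
    replace (B * _) with (Cmod (eta_prod (q * q) (S N)) * (B * Cmod (odd_prod q (S N) ^ 24))) by ring.
    apply Rmult_le_compat_l; [apply Cmod_ge_0|]. rewrite Cmod_pow.
    (* [B] is exactly the inverse of the 24th power of the lower bound: 24 * pi^2/(12u) = 2
       pi^2/u. *)
    apply Rle_trans with (B * exp (- (PI ^ 2 / (12 * u))) ^ 24).
    + right. unfold B. rewrite exp_pow, <- exp_plus. rewrite <- exp_0 at 1. f_equal.
      simpl INR. field. lra.
    + apply Rmult_le_compat_l; [left; apply exp_pos|].
      apply pow_incr. split; [left; apply exp_pos | apply odd_prod_lower; assumption].
  - apply (is_lim_seq_incr_1 (fun N => Cmod (eta_prod (q * q) N))).
    apply eta_inf_lim, Cmod_square_lt_1, Hq.
  - apply is_lim_seq_mult'; [apply is_lim_seq_const|]. apply is_lim_seq_eta_double, Hq.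
Qed.

(** * Bounds for psi and phi in terms of the nome *)

Lemma nome_double (z : C) : nome (2 * z) = (nome z * nome z)%C.
Proof. unfold nome. rewrite <- Cexp_plus. f_equal. ring. Qed.

Lemma psi_eq (z : C) :
  psi z = ((nome z * eta_inf (nome z)) / ((nome z * nome z) * eta_inf (nome z * nome z)))%C.
Proof. unfold psi, Defs.Delta, eta_inf. rewrite nome_double. reflexivity. Qed.

Lemma Cmod_pos_neq_0 (w : C) : 0 < Cmod w -> w <> 0.
Proof. intros Hw ->. rewrite Cmod_0 in Hw. lra. Qed.

Lemma Cmod_psi (z : C) : 0 < Cmod (nome z) < 1 ->
  Cmod (psi z) = Cmod (eta_inf (nome z)) / (Cmod (nome z) * Cmod (eta_inf (nome z * nome z))).
Proof.
  intros Hq. rewrite psi_eq.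
  assert (H2 := eta_inf_pos _ (Cmod_square_lt_1 _ (proj2 Hq))).
  rewrite Cmod_div, !Cmod_mult.
  - field. lra.
  - apply Cmod_pos_neq_0. rewrite !Cmod_mult. repeat apply Rmult_lt_0_compat; lra.
Qed.

Lemma Cmod_psi_le (z : C) : 0 < Cmod (nome z) < 1 ->
  Cmod (psi z) <= exp (24 * (Cmod (nome z) / (1 - Cmod (nome z) ^ 2))) / Cmod (nome z).
Proof.
  intros Hq. rewrite Cmod_psi by exact Hq.
  assert (H2 := eta_inf_pos _ (Cmod_square_lt_1 _ (proj2 Hq))).
  apply (Rmult_le_reg_r (Cmod (nome z) * Cmod (eta_inf (nome z * nome z))));
    [apply Rmult_lt_0_compat; lra|].
  eapply Rle_trans; [|eapply Rle_trans; [apply (eta_inf_le (nome z)); lra|]]; right; field; lra.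
Qed.

Lemma Cmod_phi_le (z : C) (u : R) : 0 < u -> Cmod (nome z) = exp (- u) ->
  Cmod (phi z) <= exp (2 * PI ^ 2 / u - u).
Proof.
  intros Hu Hqu. assert (Hx := exp_neg_lt_1 u Hu).
  assert (Hq : 0 < Cmod (nome z) < 1) by lra.
  assert (H1 := eta_inf_pos _ (proj2 Hq)).
  assert (H2 := eta_inf_pos _ (Cmod_square_lt_1 _ (proj2 Hq))).
  assert (Hpsi : 0 < Cmod (psi z)).
  { rewrite Cmod_psi by exact Hq. apply Rdiv_lt_0_compat; [lra|].
    apply Rmult_lt_0_compat; lra. }
  unfold phi. rewrite Cmod_div by (apply Cmod_pos_neq_0, Hpsi).
  rewrite Cmod_1, Cmod_psi by exact Hq.
  unfold Rminus at 1. rewrite exp_plus, <- Hqu.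
  apply (Rmult_le_reg_r (Cmod (eta_inf (nome z)))); [lra|].
  eapply Rle_trans; [right|].
  - instantiate (1 := Cmod (nome z) * Cmod (eta_inf (nome z * nome z))). field. lra.
  - replace (exp (2 * PI ^ 2 / u) * Cmod (nome z) * Cmod (eta_inf (nome z)))
      with (Cmod (nome z) * (exp (2 * PI ^ 2 / u) * Cmod (eta_inf (nome z)))) by ring.
    apply Rmult_le_compat_l; [lra|]. apply eta_inf_square_le; assumption.
Qed.

(** * The coefficients *)

(** Transfers the hypotheses, stated on the upper half-plane, to every circle |q| = exp a < 1, as
    [cauchy_estimate] requires. *)
Lemma nome_surjective (a t : R) : a < 0 ->
  exists z : C, 0 < Im z /\ nome z = Cexp (a, t).
Proof.
  intros Ha. assert (Hpi := PI_RGT_0).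
  exists (t / (2 * PI), - a / (2 * PI)). split.
  - unfold Im; simpl. apply Rdiv_lt_0_compat; lra.
  - unfold nome. f_equal. unfold Cmult, Ci, RtoC; simpl. f_equal; field; lra.
Qed.

Lemma is_series_C_decr_1 (f : nat -> C) (l : C) :
  is_series (K := C_AbsRing) (V := C_NormedModule) (fun k => f (S k)) l ->
  is_series (K := C_AbsRing) (V := C_NormedModule) f (f 0%nat + l)%C.
Proof.
  intros H. apply is_series_decr_1.
  replace (plus _ _) with l; [exact H|].
  change (l = (f 0%nat + l + - f 0%nat)%C). ring.
Qed.

Lemma b_coefficient_bound (b : nat -> Z) (u : R) (n : nat) :
  (forall z : C, 0 < Im z -> is_qseries b z (phi z)) ->
  0 < u -> (1 <= n)%nat ->
  Rabs (IZR (b n)) <= exp (INR n * u + 2 * PI ^ 2 / u - u).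
Proof.
  intros hb Hu Hn.
  set (c k := match k with O => 0 | S _ => IZR (b k) end).
  assert (H : Rabs (c n) * exp (INR n * - u) <= exp (2 * PI ^ 2 / - - u - - - u)).
  { apply (cauchy_estimate c (fun a => exp (2 * PI ^ 2 / - a - - a))); [|lra].
    intros a t Ha. destruct (nome_surjective a t Ha) as [z [Hz Hq]].
    exists (phi z). split.
    - replace (phi z) with (c 0%nat * Cexp (a, t) ^ 0 + phi z)%C by (simpl; ring).
      apply (is_series_C_decr_1 (fun k => (c k * Cexp (a, t) ^ k)%C)).
      rewrite <- Hq. exact (hb z Hz).
    - apply Cmod_phi_le; [lra|]. rewrite Hq, Cmod_Cexp. simpl. f_equal; ring. }
  destruct n as [|n]; [lia|]. change (c (S n)) with (IZR (b (S n))) in H.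
  apply (Rmult_le_reg_r (exp (INR (S n) * - u))); [apply exp_pos|].
  eapply Rle_trans; [exact H|]. rewrite <- exp_plus. apply exp_monotone.
  rewrite !Ropp_involutive. lra.
Qed.

Lemma s_coefficient_bound (s : nat -> Z) (u : R) (n : nat) :
  (forall z : C, 0 < Im z ->
     exists l : C, is_qseries s z l /\ psi z = (/ nome z - 24 + l)%C) ->
  0 < u -> (1 <= n)%nat ->
  Rabs (IZR (s n)) <= exp (INR (S n) * u + 24 * (exp (- u) / (1 - exp (- u) ^ 2))).
Proof.
  intros hs Hu Hn.
  (* Coefficients of q psi: multiplying by q removes the pole and shifts the index, so s(n) is
     coefficient n + 1. *)
  set (c k := match k with O => 1 | 1%nat => - 24 | S m => IZR (s m) end).
  assert (H : Rabs (c (S n)) * exp (INR (S n) * - u)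
              <= exp (24 * (exp (- u) / (1 - exp (- u) ^ 2)))).
  { apply (cauchy_estimate c (fun a => exp (24 * (exp a / (1 - exp a ^ 2))))); [|lra].
    intros a t Ha. destruct (nome_surjective a t Ha) as [z [Hz Hq]].
    destruct (hs z Hz) as [l [Hl Hpsi]]. rewrite <- Hq.
    assert (Hx : Cmod (nome z) = exp a) by (rewrite Hq, Cmod_Cexp; reflexivity).
    assert (Hx1 : 0 < Cmod (nome z) < 1).
    { rewrite Hx, <- (Ropp_involutive a). apply exp_neg_lt_1. lra. }
    assert (Hq0 := Cmod_pos_neq_0 _ (proj1 Hx1)).
    exists (nome z * psi z)%C. split.
    - replace (nome z * psi z)%C
        with (c 0%nat * nome z ^ 0 + (c 1%nat * nome z ^ 1 + nome z * l))%C.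
      2:{ rewrite Hpsi. simpl. change (RtoC (-24)) with (RtoC (Ropp 24)).
          rewrite RtoC_opp. field. exact Hq0. }
      apply (is_series_C_decr_1 (fun k => (c k * nome z ^ k)%C)).
      apply (is_series_C_decr_1 (fun k => (c (S k) * nome z ^ S k)%C)).
      apply (is_series_ext (K := C_AbsRing) (V := C_NormedModule)
        (fun k => scal (nome z) (IZR (s (S k)) * nome z ^ S k)%C)).
      + intros k. change (scal (nome z)) with (Cmult (nome z)). simpl. ring.
      + apply (is_series_scal (K := C_AbsRing) (V := C_NormedModule)). exact Hl.
    - rewrite Cmod_mult, <- Hx.
      apply Rle_trans with (Cmod (nome z) *
        (exp (24 * (Cmod (nome z) / (1 - Cmod (nome z) ^ 2))) / Cmod (nome z))).
      + apply Rmult_le_compat_l; [lra | apply Cmod_psi_le, Hx1].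
      + right. field. lra. }
  destruct n as [|n]; [lia|]. change (c (S (S n))) with (IZR (s (S n))) in H.
  apply (Rmult_le_reg_r (exp (INR (S (S n)) * - u))); [apply exp_pos|].
  eapply Rle_trans; [exact H|]. rewrite <- exp_plus. apply exp_monotone. lra.
Qed.

(** * Choice of the radii and numerical verification *)

Theorem theorem1p3 (s b : nat -> Z)
  (hs : forall z : C, 0 < Im z ->
     exists l : C, is_qseries s z l /\ psi z = (/ nome z - 24 + l)%C)
  (hb : forall z : C, 0 < Im z -> is_qseries b z (phi z)) :
  forall n : nat, (1 <= n)%nat ->
    Rabs (IZR (s n)) < 0.9 * INR n ^ 11 * exp (2 * PI * sqrt (2 * INR n)) /\
    IZR (b n) < 0.08 * INR n ^ 11 * exp (2 * PI * sqrt (2 * INR n)).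
Proof.
  intros n Hn.
  assert (Hn1 : 1 <= INR n) by (apply (le_INR 1), Hn).
  assert (Hpi : 3 < PI) by (generalize PI2_3_2; lra).
  set (sg := sqrt (2 * INR n)).
  assert (Hsg : 0 < sg) by (apply sqrt_lt_R0; lra).
  assert (Hsg2 : sg * sg = 2 * INR n) by (apply sqrt_sqrt; lra).
  assert (He := exp_pos (2 * PI * sg)).
  assert (Hpow : (2 <= n)%nat -> 2048 <= INR n ^ 11).
  { intros H. replace 2048 with (2 ^ 11) by ring. apply pow_incr.
    split; [lra|]. apply (le_INR 2), H. }
  split.
  - destruct (Nat.eq_dec n 1) as [->|Hn'].
    (* Here the simplified bound 12/u fails: 2u + 12/u is at least 4 sqrt 6, above 2 pi sqrt 2. So
       x/(1-x^2) is kept, and u = 5/2 nearly minimises the exponent. *)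
    + assert (H := s_coefficient_bound s (5 / 2) 1 hs ltac:(lra) ltac:(lia)).
      simpl INR in *.
      assert (Hx0 := exp_neg_lt_1 (5 / 2) ltac:(lra)).
      assert (Hx : exp (- (5 / 2)) <= 0.1317).
      { assert (H5 : (3 / 2) ^ 5 <= exp (5 / 2)).
        { replace (5 / 2) with (INR 5 * (1 / 2)) by (simpl; field). rewrite <- exp_pow.
          apply pow_incr. assert (H1 := exp_ineq1_le (1 / 2)). lra. }
        rewrite exp_Ropp. apply Rle_trans with (/ (3 / 2) ^ 5); [|lra].
        apply Rinv_le_contravar; lra. }
      set (x := exp (- (5 / 2))) in *.
      assert (Hfrac : x / (1 - x ^ 2) <= 0.1341).
      { apply (Rmult_le_reg_r (1 - x ^ 2)); [nra|].
        replace (x / (1 - x ^ 2) * (1 - x ^ 2)) with x by (field; nra). nra. }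
      assert (Hsg14 : 1.4 <= sg) by nra.
      (* Numerically 5 + 24 * 0.1341 < 8.22 = 2 * 3 * 1.4 - 0.18; the slack 0.18 pays for the factor
         0.9. *)
      assert (Hexp : exp (2 * (5 / 2) + 24 * (x / (1 - x ^ 2)))
                     <= exp (2 * PI * sg) * exp (- (0.18))).
      { rewrite <- exp_plus. apply exp_monotone. nra. }
      assert (H18 : exp (- (0.18)) < 0.9).
      { rewrite exp_Ropp. apply Rle_lt_trans with (/ 1.18); [|lra].
        apply Rinv_le_contravar; [lra|]. assert (H1 := exp_ineq1_le 0.18). lra. }
      replace (1 + 1) with 2 in H by ring. rewrite pow1. nra.
    (* This makes 12/u equal to pi sqrt (2n), half of the target exponent. The other half must cover
       (n+1)u, that is 12(n+1) <= 2 pi^2 n; with pi^2 >= 9 this holds from n = 2 on. *)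
    + set (u := 12 / (PI * sg)).
      assert (Hps : 0 < PI * sg) by (apply Rmult_lt_0_compat; lra).
      assert (Hu : 0 < u) by (apply Rdiv_lt_0_compat; lra).
      assert (H := s_coefficient_bound s u n hs Hu Hn).
      assert (Hn2 : 2 <= INR n) by (apply (le_INR 2); lia).
      assert (Hb : INR (S n) * u + 24 * (exp (- u) / (1 - exp (- u) ^ 2)) <= 2 * PI * sg).
      { assert (Hg := odd_geometric_le u Hu).
        assert (Hu2 : 24 * / (2 * u) = PI * sg) by (unfold u; field; lra).
        assert (INR (S n) * u <= PI * sg); [|lra].
        rewrite S_INR. unfold u. apply (Rmult_le_reg_r (PI * sg)); [lra|].
        replace ((INR n + 1) * (12 / (PI * sg)) * (PI * sg)) with (12 * (INR n + 1)) by (field; lra).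
        replace (PI * sg * (PI * sg)) with (PI * PI * (sg * sg)) by ring.
        rewrite Hsg2. assert (Hpi2 : 9 <= PI * PI) by nra.
        apply Rle_trans with (9 * (2 * INR n)); [lra|].
        apply Rmult_le_compat_r; lra. }
      apply exp_monotone in Hb. specialize (Hpow ltac:(lia)). nra.
  (* The minimiser of nu + 2 pi^2/u, where both terms equal pi sqrt (2n). *)
  - set (u := 2 * PI / sg).
    assert (Hu : 0 < u) by (apply Rdiv_lt_0_compat; lra).
    assert (H := b_coefficient_bound b u n hb Hu Hn).
    replace (INR n * u + 2 * PI ^ 2 / u - u) with (2 * PI * sg + - u) in H.
    2:{ replace (INR n) with (sg * sg / 2) by lra. unfold u. field. lra. }
    rewrite exp_plus in H.
    (* The factor exp (-u), coming from the leading q in [phi], is needed at n = 1: there u >= 4 and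
       exp (-4) <= 1/16 < 0.08. For n >= 2 it suffices that it is below 1. *)
    assert (Hexp : exp (- u) < 0.08 * INR n ^ 11).
    { destruct (Nat.eq_dec n 1) as [->|Hn'].
      - simpl INR in *. rewrite pow1.
        assert (Hsg15 : sg <= 3 / 2) by nra.
        assert (Hu4 : 4 <= u).
        { unfold u. apply (Rmult_le_reg_r sg); [lra|].
          replace (2 * PI / sg * sg) with (2 * PI) by (field; lra). lra. }
        assert (H4 : 2 ^ 4 <= exp 4).
        { replace 4 with (INR 4 * 1) by (simpl; ring). rewrite <- exp_pow.
          apply pow_incr. assert (H1 := exp_ineq1_le 1). lra. }
        rewrite exp_Ropp. apply Rle_lt_trans with (/ 2 ^ 4); [|lra].
        apply Rinv_le_contravar; [lra|].
        eapply Rle_trans; [exact H4 | apply exp_monotone, Hu4].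
      - specialize (Hpow ltac:(lia)). destruct (exp_neg_lt_1 u Hu). lra. }
    assert (Hle := Rle_abs (IZR (b n))). nra.
Qed.
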